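(* Let $n\geqslant 1$ and consider $n$-valued groups on the set $X=\{e,x_1,x_2\}$ with unit $e$. Groups from the series $B_1$ are involutive. A group from the series $B_2$ is involutive if and only if $b_0=0$.
   Context: $\mathrm{Sym}^n(X)=X^{n}/S_n$ is the set of $n$-element multisets of elements of $X$; a multiset is written as a formal sum $\sum_{x\in X} m_x\, x$ with non-negative integer multiplicities summing to $n$. An $n$-valued monoid is a set $X$ with an operation $\ast:X\times X\to \mathrm{Sym}^n(X)$ such that: (associativity) for all $x,y,z\in X$ the $n^2$-multisets $[x\ast w\mid w\in y\ast z]$ and $[w\ast z\mid w\in x\ast y]$ coincide (with $w$ running with multiplicity); (unit) there is $e\in X$ with $e\ast x=x\ast e=[x,\dots,x]$ ($n$ times) for every $x\in X$. An $n$-valued group is an $n$-valued monoid equipped with a map $\mathrm{inv}:X\to X$ such that $e\in x\ast \mathrm{inv}(x)$ and $e\in \mathrm{inv}(x)\ast x$ for every $x\in X$. For an $n$-valued group put $\mathrm{Inv}(x)=\{y\in X\mid e\in x\ast y,\ e\in y\ast x\}$. The group is reversible if $\mathrm{Inv}(x)=\{\mathrm{inv}(x)\}$ for every $x\in X$. A reversible $n$-valued group is involutive if $\mathrm{inv}(x)=x$ for every $x\in X$. An $n$-valued monoid structure on $X=\{e,x_1,x_2\}$ with unit $e$ is given by the $4\times3$ matrix $B$ whose rows list, in order, the multiplicities of $(e,x_1,x_2)$ in $x_1\ast x_1$, $x_1\ast x_2$, $x_2\ast x_1$, $x_2\ast x_2$. It belongs to the series $B_1$ (respectively $B_2$) if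 its matrix has the form $$B_1=\begin{pmatrix} a_0 & n-a_0 & 0\\ 0&0&n\\ 0&0&n\\ c_0 & \frac{c_0n}{a_0} & n-c_0-\frac{c_0n}{a_0}\end{pmatrix}\quad (a_0\ne 0),$$ respectively $$B_2=\begin{pmatrix} a_0&a_1&n-a_0-a_1\\ b_0&b_1&n-b_0-b_1\\ b_0&b_1&n-b_0-b_1\\ \frac{b_0(n-b_0-b_1)+a_0b_1-a_1b_0}{n-a_0-a_1} & \frac{(b_0+b_1)(n-b_1)}{n-a_0-a_1} & \frac{(n-b_0-b_1)^2+n(b_1-a_0-a_1)+a_1b_0-a_0b_1}{n-a_0-a_1}\end{pmatrix}\quad (n-a_0-a_1\neq 0),$$ where $a_0,a_1,b_0,b_1,c_0$ are parameters and all entries are non-negative integers. A ''group from the series $B_j$'' is an $n$-valued group on $X$ whose underlying $n$-valued monoid belongs to the series $B_j$. *)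

(* Defs.v *)
From mathcomp Require Import all_boot all_order all_algebra.
From mathcomp Require Import finmap multiset.

Set Implicit Arguments.
Unset Strict Implicit.
Unset Printing Implicit Defensive.

Import GRing.Theory.
Local Open Scope mset_scope.

(* Sym^n(X): multisets of total multiplicity n. A multiset is a finitely
   supported multiplicity function; [enum_mset] lists its elements with
   multiplicity. *)
Record Sym (n : nat) (X : choiceType) : Type := MkSym {
  sym_mset :> {mset X};
  sym_size : size sym_mset = n
}.

Record nv_monoid (n : nat) (X : choiceType) : Type := NVMonoid {
  nv_mul : X -> X -> Sym n X;
  nv_unit : X;
  (* Equality of the two n^2-multisets, as lists up to permutation. *)
  nv_mulA : forall x y z : X,
    perm_eq [seq u | w <- enum_mset (nv_mul y z), u <- enum_mset (nv_mul x w)]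
            [seq u | w <- enum_mset (nv_mul x y), u <- enum_mset (nv_mul w z)];
  nv_mul1 : forall x : X, nv_mul nv_unit x = msetn n x :> {mset X};
  nv_mulr1 : forall x : X, nv_mul x nv_unit = msetn n x :> {mset X}
}.

Record nv_group (n : nat) (X : choiceType) : Type := NVGroup {
  nv_group_monoid :> nv_monoid n X;
  nv_inv : X -> X;
  nv_mulxV : forall x : X,
    nv_unit nv_group_monoid \in sym_mset (nv_mul nv_group_monoid x (nv_inv x));
  nv_mulVx : forall x : X,
    nv_unit nv_group_monoid \in sym_mset (nv_mul nv_group_monoid (nv_inv x) x)
}.

Definition nv_Inv (n : nat) (X : choiceType) (G : nv_group n X) (x : X) :
    pred X :=
  [pred y | (nv_unit G \in sym_mset (nv_mul G x y)) &&
            (nv_unit G \in sym_mset (nv_mul G y x))].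

Definition reversible (n : nat) (X : choiceType) (G : nv_group n X) : Prop :=
  forall x : X, nv_Inv G x =i pred1 (nv_inv G x).

Definition involutive_nv_group (n : nat) (X : choiceType) (G : nv_group n X) :
    Prop :=
  reversible G /\ forall x : X, nv_inv G x = x.

Local Open Scope ring_scope.

Definition mx43_of_rows (rows : seq (seq rat)) : 'M[rat]_(4, 3) :=
  \matrix_(i < 4, j < 3) nth 0 (nth [::] rows i) j.

(* The entries are cast to rat because the parametric forms of the series below
   involve fractions. *)
Definition structure_mx (n : nat) (X : choiceType) (M : nv_monoid n X)
    (x1 x2 : X) : 'M[rat]_(4, 3) :=
  let row x y := [seq (sym_mset (nv_mul M x y) t)%:R | t <- [:: nv_unit M; x1; x2]] in
  mx43_of_rows [:: row x1 x1; row x1 x2; row x2 x1; row x2 x2].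

Definition B1_mx (n a0 c0 : rat) : 'M[rat]_(4, 3) :=
  mx43_of_rows
    [:: [:: a0; n - a0; 0];
        [:: 0; 0; n];
        [:: 0; 0; n];
        [:: c0; c0 * n / a0; n - c0 - c0 * n / a0]].

Definition B2_mx (n a0 a1 b0 b1 : rat) : 'M[rat]_(4, 3) :=
  mx43_of_rows
    [:: [:: a0; a1; n - a0 - a1];
        [:: b0; b1; n - b0 - b1];
        [:: b0; b1; n - b0 - b1];
        [:: (b0 * (n - b0 - b1) + a0 * b1 - a1 * b0) / (n - a0 - a1);
            (b0 + b1) * (n - b1) / (n - a0 - a1);
            ((n - b0 - b1) ^+ 2 + n * (b1 - a0 - a1) + a1 * b0 - a0 * b1)
              / (n - a0 - a1)]].

(* Subtraction and division take place in rat; that the remaining entries are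
   non-negative integers follows from the equality with [structure_mx]. *)
Definition series_B1 (n : nat) (X : choiceType) (M : nv_monoid n X)
    (x1 x2 : X) (a0 c0 : nat) : Prop :=
  a0 <> 0%N /\ structure_mx M x1 x2 = B1_mx n%:R a0%:R c0%:R.

Definition series_B2 (n : nat) (X : choiceType) (M : nv_monoid n X)
    (x1 x2 : X) (a0 a1 b0 b1 : nat) : Prop :=
  n%:R - a0%:R - a1%:R != 0 :> rat /\
  structure_mx M x1 x2 = B2_mx n%:R a0%:R a1%:R b0%:R b1%:R.

(* Main.v *)
Require Import Defs.
From mathcomp Require Import all_boot all_order all_algebra.
From mathcomp Require Import finmap multiset.

(** The multiplicities of the unit in the products already decide involutivity.
Being mutually inverse, [y \in nv_Inv G x], is a symmetric relation on [X] in
which every [x] is related to [nv_inv G x]; hence [G] is involutive exactly when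
this relation is contained in equality ([involutive_nv_groupP]). The unit is
related only to itself, so on [{e, x1, x2}] the sole possible offending pair is
[(x1, x2)], and [G] is involutive if and only if [x2] is not inverse to [x1]
([involutive_nv_group3P]). Both series have equal second and third rows, so this
says that the multiplicity of [e] in [x1 * x2] vanishes. That multiplicity is
[0] in [B1] and [b0] in [B2]. *)

Set Implicit Arguments.
Unset Strict Implicit.
Unset Printing Implicit Defensive.

Section Involutivity.

Variables (n : nat) (X : choiceType) (G : nv_group n X).

Lemma nv_Inv_sym (x y : X) : (x \in nv_Inv G y) = (y \in nv_Inv G x).
Proof. by rewrite !inE andbC. Qed.

Lemma nv_inv_Inv (x : X) : nv_inv G x \in nv_Inv G x.
Proof. by rewrite inE nv_mulxV nv_mulVx. Qed.

(** From right to left, [nv_inv G x] is itself an inverse of [x], so it has to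
be [x]; this gives reversibility along with involutivity. *)
Lemma involutive_nv_groupP :
  involutive_nv_group G <-> (forall x y : X, y \in nv_Inv G x -> y = x).
Proof.
split=> [[revG invG] x y | Inv_eq].
  by rewrite revG inE invG => /eqP.
have invG x : nv_inv G x = x by apply/Inv_eq/nv_inv_Inv.
split=> // x y; rewrite [RHS]inE invG.
by apply/idP/eqP => [/Inv_eq | ->] //; rewrite -{1}(invG x) nv_inv_Inv.
Qed.

Lemma nv_Inv_unit (y : X) : y \in nv_Inv G (nv_unit G) -> y = nv_unit G.
Proof.
rewrite inE nv_mul1 in_mset msetnE => /andP[+ _].
by case: eqP.
Qed.

Lemma involutive_nv_group3P (x1 x2 : X) :
    x1 != x2 -> (forall x : X, x \in [:: nv_unit G; x1; x2]) ->
  involutive_nv_group G <-> x2 \notin nv_Inv G x1.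
Proof.
move=> x1x2 X_enum; split=> [/involutive_nv_groupP Inv_eq | x2NInv].
  by apply: contraNN x1x2 => /Inv_eq ->.
apply/involutive_nv_groupP => x y.
have := X_enum x; rewrite 3!in_cons in_nil orbF => /or3P[] /eqP->.
- exact: nv_Inv_unit.
- have := X_enum y; rewrite 3!in_cons in_nil orbF => /or3P[] /eqP-> //.
  + by rewrite nv_Inv_sym => /nv_Inv_unit.
  + by rewrite (negPf x2NInv).
- have := X_enum y; rewrite 3!in_cons in_nil orbF => /or3P[] /eqP-> //.
  + by rewrite nv_Inv_sym => /nv_Inv_unit.
  + by rewrite nv_Inv_sym (negPf x2NInv).
Qed.

End Involutivity.

Local Open Scope ring_scope.

(** The treatment common to both series: only the first entries of the two
middle rows matter, and since the cast from [nat] to [rat] is injective they can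
be compared as integers; the fractions of the last row never enter. *)
Lemma involutive_structure_mx (n : nat) (X : choiceType) (x1 x2 : X)
    (G : nv_group n X) (b : nat) :
    x1 != x2 -> (forall x : X, x \in [:: nv_unit G; x1; x2]) ->
    structure_mx G x1 x2 1 0 = b%:R -> structure_mx G x1 x2 2 0 = b%:R ->
  involutive_nv_group G <-> b = 0%N.
Proof.
move=> x1x2 X_enum; rewrite !mxE /=.
move=> /eqP; rewrite Num.Theory.eqr_nat => /eqP e12.
move=> /eqP; rewrite Num.Theory.eqr_nat => /eqP e21.
apply: (iff_trans (involutive_nv_group3P x1x2 X_enum)).
rewrite inE !in_mset e12 e21 andbb -eqn0Ngt.
by split=> /eqP.
Qed.

Theorem corollary6 (n : nat) (X : choiceType) (x1 x2 : X) (G : nv_group n X)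
    (n_ge1 : (1 <= n)%N)
    (X_uniq : uniq [:: nv_unit G; x1; x2])
    (X_enum : forall x : X, x \in [:: nv_unit G; x1; x2]) :
  (forall a0 c0 : nat, series_B1 G x1 x2 a0 c0 -> involutive_nv_group G) /\
  (forall a0 a1 b0 b1 : nat, series_B2 G x1 x2 a0 a1 b0 b1 ->
     (involutive_nv_group G <-> b0 = 0%N)).
Proof.
have x1x2 : x1 != x2 by case/and3P: X_uniq => _; rewrite inE.
split=> [a0 c0 [_ strG] | a0 a1 b0 b1 [_ strG]].
  by apply: (involutive_structure_mx x1x2 X_enum _ _).2 (erefl 0%N);
    rewrite strG mxE.
by apply: (involutive_structure_mx x1x2 X_enum); rewrite strG mxE.
Qed.
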